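(* Let $x=P(x)$ be a quadratic monotone polynomial system (MPS) in $n$ variables whose polynomials have rational coefficients, with total encoding size $|P|$ bits, and suppose its least fixed point $q^*\in\mathbb{R}^n_{\ge 0}$ satisfies $q^*>0$ (all coordinates positive). Then (1) $q^*_{\min}\ge 2^{-|P|(2^{n}-1)}$, and (2) $q^*_{\max}\le 2^{2(n+1)(|P|+2(n+1)\log(2n+2))\cdot 5^{n}}$, where $q^*_{\min}=\min_i q^*_i$ and $q^*_{\max}=\max_i q^*_i$.
   Context: An MPS is a system $x_i=P_i(x)$, $i=1,\dots,n$, where each $P_i$ is a multivariate polynomial in $x=(x_1,\dots,x_n)$ with nonnegative coefficients and nonnegative constant term. It is quadratic if every $P_i$ has total degree at most $2$. A least fixed point (LFP) is a solution $q^*\in\mathbb{R}^n_{\ge0}$ of $x=P(x)$ with $q^*\le a$ coordinatewise for every solution $a\in\mathbb{R}^n_{\ge 0}$. The encoding size $|P|$ is the number of bits used when each $P_i$ is given as a list of (coefficient, exponent vector) pairs, each rational coefficient given by numerator and denominator in binary and each exponent vector given sparsely by its nonzero coordinates (index and value in binary). Logarithms are base 2. *)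

(* Defs.v *)
From HB Require Import structures.
From mathcomp Require Import all_boot all_order all_algebra.
From mathcomp Require Import reals exp.
From mathcomp Require Import mpoly.

Set Implicit Arguments.
Unset Strict Implicit.
Unset Printing Implicit Defensive.

Import Order.TTheory GRing.Theory Num.Theory.
Local Open Scope ring_scope.

(* The constant term is the coefficient of the monomial 0, so it is covered. *)
Definition is_MPS (n : nat) (P : 'I_n -> {mpoly rat[n]}) : Prop :=
  forall (i : 'I_n) (m : 'X_{1..n}), 0 <= (P i)@_m.

(* [msize p] is one plus the total degree of [p], and 0 when [p = 0]. *)
Definition quadratic (n : nat) (P : 'I_n -> {mpoly rat[n]}) : Prop :=
  forall i : 'I_n, (msize (P i) <= 3)%N.

Definition nneg_fixpoint (R : realType) (n : nat) (P : 'I_n -> {mpoly rat[n]})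
    (x : 'I_n -> R) : Prop :=
  (forall i, 0 <= x i) /\ (forall i, x i = (map_mpoly ratr (P i)).@[x]).

Definition is_LFP (R : realType) (n : nat) (P : 'I_n -> {mpoly rat[n]})
    (q : 'I_n -> R) : Prop :=
  nneg_fixpoint P q /\
  forall a : 'I_n -> R, nneg_fixpoint P a -> forall i, q i <= a i.

(* Number of binary digits of [k]; 0 is written with one digit. *)
Definition bitlen (k : nat) : nat := (trunc_log 2 k).+1.

(* Numerator and denominator in lowest terms; all coefficients are nonnegative
   for an MPS, so there is no sign to record. *)
Definition coef_size (c : rat) : nat := (bitlen `|numq c| + bitlen `|denq c|)%N.

(* Variables are numbered from 1, whereas ordinals start at 0. *)
Definition expvec_size (n : nat) (m : 'X_{1..n}) : nat :=
  (\sum_(j < n | m j != 0) (bitlen j.+1 + bitlen (m j)))%N.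

Definition poly_size (n : nat) (p : {mpoly rat[n]}) : nat :=
  (\sum_(m <- msupp p) (coef_size p@_m + expvec_size m))%N.

(* Delimiters between the binary numbers are not counted; counting them would
   only enlarge the size, hence weaken bounds that are monotone in it. *)
Definition enc_size (n : nat) (P : 'I_n -> {mpoly rat[n]}) : nat :=
  (\sum_(i < n) poly_size (P i))%N.

Definition vec_min (R : realType) (n : nat) (n_gt0 : (0 < n)%N)
    (x : 'I_n -> R) : R :=
  \big[Num.min/x (Ordinal n_gt0)]_(i < n) x i.

Definition vec_max (R : realType) (n : nat) (n_gt0 : (0 < n)%N)
    (x : 'I_n -> R) : R :=
  \big[Num.max/x (Ordinal n_gt0)]_(i < n) x i.

Definition log2 (R : realType) (x : R) : R := ln x / ln 2.

(* Main.v *)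
Require Import Defs.
From HB Require Import structures.
From mathcomp Require Import all_boot all_order all_algebra.
From mathcomp Require Import reals exp.
From mathcomp Require Import mpoly.
From mathcomp Require Import perm polyXY ring lra zify.

Set Implicit Arguments.
Unset Strict Implicit.
Unset Printing Implicit Defensive.

Import Order.TTheory GRing.Theory Num.Theory.
Local Open Scope ring_scope.

(** Lower bound.  The map [P] raises the set of coordinates known to be positive
    at least one at a time, so [n] steps suffice; each step multiplies two
    coordinates of the previous level and a coefficient at least [2^-|P|].

    Upper bound.  For [e > 0] the system [x_i + e x_i^3 = P_i(x)] has a least
    nonnegative solution, below [q], and these solutions increase to [q] as
    [e -> 0].  With [D] a common denominator and [u = 1/(D e)] it reads
    [x_i^3 = u (D P_i(x) - D x_i)], which rewrites every monomial as a [Z[u]]-linear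
    combination of the [3^n] monomials with exponents at most 2.  Hence [x_j] is an
    eigenvalue of an explicit matrix over [Z[u]], whose characteristic polynomial
    is a nonzero element of [Z[u][t]] of controlled l1-norm [H].  As [u] tends to
    infinity the roots are governed by the leading coefficient in [u], a nonzero
    integer polynomial in [t] of norm at most [H], so that [q_j <= H]. *)

(** * l1-norms of polynomials and determinants *)

Section L1Norm.
Variables (A : nzRingType) (f : A -> nat).
Hypotheses (f0 : f 0 = 0%N) (fD : forall a b, (f (a + b) <= f a + f b)%N).
Hypothesis fM : forall a b, (f (a * b) <= f a * f b)%N.

(** Taken relative to a size [f] on the coefficients so that it can be iterated: [l1int] on Z[u]
    serves as the coefficient size for [l1int2] on Z[u][t]. *)
Definition l1norm (p : {poly A}) : nat := (\sum_(i < size p) f p`_i)%N.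

Lemma l1norm_widen N (p : {poly A}) :
  (size p <= N)%N -> l1norm p = (\sum_(i < N) f p`_i)%N.
Proof.
move=> sp; rewrite /l1norm (big_ord_widen _ (fun i => f p`_i) sp) big_mkcond /=.
by apply: eq_bigr => i _; case: ltnP => // /(nth_default 0) ->; rewrite f0.
Qed.

Lemma l1normC a : l1norm a%:P = f a.
Proof.
rewrite (@l1norm_widen 1) ?size_polyC; last by case: eqP.
by rewrite big_ord_recl big_ord0 coefC addn0.
Qed.

Lemma l1norm0 : l1norm 0 = 0%N.
Proof. by rewrite -[0]/(0%:P) l1normC f0. Qed.

Lemma l1normD p q : (l1norm (p + q) <= l1norm p + l1norm q)%N.
Proof.
pose N := maxn (size p) (size q).
rewrite (@l1norm_widen N) ?size_polyD // (@l1norm_widen N p) ?leq_maxl //.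
rewrite (@l1norm_widen N q) ?leq_maxr // -big_split leq_sum // => i _.
by rewrite coefD fD.
Qed.

Lemma l1norm_consXC p c : l1norm (p * 'X + c%:P) = (l1norm p + f c)%N.
Proof.
have sz : (size (p * 'X + c%:P)%R <= (size p).+1)%N.
  by rewrite size_MXaddC; case: ifP.
rewrite (l1norm_widen sz) big_ord_recl /= addnC coefD coefMX coefC add0r.
by congr addn; apply: eq_bigr => i _; rewrite coefD coefMX coefC /= addr0.
Qed.

Lemma l1norm_mulC c p : (l1norm (c%:P * p) <= f c * l1norm p)%N.
Proof.
rewrite (@l1norm_widen (size p)); last first.
  by rewrite mul_polyC size_scale_leq.
by rewrite /l1norm big_distrr leq_sum // => i _; rewrite coefCM fM.
Qed.

(** Horner induction on [p]: multiplication by ['X] shifts the coefficients and keeps the norm. *)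
Lemma l1normM p q : (l1norm (p * q) <= l1norm p * l1norm q)%N.
Proof.
elim/poly_ind: p => [|p c IHp]; first by rewrite mul0r l1norm0.
rewrite mulrDl -mulrA -commr_polyX mulrA l1norm_consXC mulnDl.
apply: leq_trans (l1normD _ _) _; apply: leq_add (l1norm_mulC _ _).
by have := l1norm_consXC (p * q) 0; rewrite f0 addr0 addn0 => ->.
Qed.

Lemma l1normX : l1norm 'X = f 1.
Proof. by have := l1norm_consXC 1%:P 0; rewrite mul1r addr0 f0 addn0 l1normC. Qed.

Lemma l1normN p : (forall a, f (- a) = f a) -> l1norm (- p) = l1norm p.
Proof. by move=> fN; rewrite /l1norm size_polyN; apply: eq_bigr => i _; rewrite coefN fN. Qed.

Lemma l1norm_coef (p : {poly A}) i : (f p`_i <= l1norm p)%N.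
Proof.
case: (ltnP i (size p)) => [ltip|lepi]; last by rewrite nth_default // f0.
by rewrite /l1norm (bigD1 (Ordinal ltip)) //= leq_addr.
Qed.

Lemma l1norm_sum (I : Type) (r : seq I) (F : I -> {poly A}) :
  (l1norm (\sum_(i <- r) F i) <= \sum_(i <- r) l1norm (F i))%N.
Proof.
elim/big_rec2: _ => [|i m p _ IH]; first by rewrite l1norm0.
by apply: leq_trans (l1normD _ _) _; rewrite leq_add2l.
Qed.
End L1Norm.

(** Leibniz formula: the product of the row sums expands over all self-maps of the index set, and
    the permutations supply only some of these nonnegative terms. *)
Lemma submult_det_bound (S : comNzRingType) (g : S -> nat) N (A : 'M[S]_N) :
    g 0 = 0%N -> (g 1%R <= 1)%N -> (forall a, g (- a) = g a) ->
    (forall a b, (g (a + b)%R <= g a + g b)%N) ->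
    (forall a b, (g (a * b)%R <= g a * g b)%N) ->
  (g (\det A) <= \prod_i \sum_j g (A i j))%N.
Proof.
move=> g0 g1 gN gD gM.
have gsg (b : bool) : (g ((-1) ^+ b)%R <= 1)%N by case: b; rewrite ?expr1 ?gN ?expr0.
apply: (@leq_trans (\sum_(s : 'S_N) \prod_i g (A i (s i)))%N).
  rewrite /determinant; elim/big_rec2: _ => [|s m a _ IH]; first by rewrite g0.
  apply: leq_trans (gD _ _) _; rewrite leq_add //.
  apply: leq_trans (gM _ _) _; rewrite -[leqRHS]mul1n leq_mul //.
  elim/big_rec2: _ => // i b c _ IH'.
  by apply: leq_trans (gM _ _) _; rewrite leq_mul2l IH' orbT.
rewrite bigA_distr_bigA /=.
pose h (s : 'S_N) : {ffun 'I_N -> 'I_N} := [ffun i => s i].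
have injh : injective h.
  by move=> s t /ffunP e; apply/permP => i; have := e i; rewrite !ffunE.
rewrite [leqRHS](bigID (fun F : {ffun 'I_N -> 'I_N} => F \in [set h s | s : 'S_N])) /=.
apply: leq_trans (leq_addr _ _).
rewrite big_imset /=; last by move=> s t _ _; apply: injh.
apply: eq_leq; apply: eq_bigr => s _; apply: eq_bigr => i _.
by rewrite ffunE.
Qed.

Definition l1int : {poly int} -> nat := l1norm absz.
Definition l1int2 : {poly {poly int}} -> nat := l1norm l1int.

Lemma abszD_le (a b : int) : (absz (a + b)%R <= absz a + absz b)%N. Proof. lia. Qed.
Lemma abszM_le (a b : int) : (absz (a * b)%R <= absz a * absz b)%N.
Proof. by rewrite abszM. Qed.

Lemma l1int0 : l1int 0 = 0%N. Proof. exact: l1norm0. Qed.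
Lemma l1intD p q : (l1int (p + q)%R <= l1int p + l1int q)%N.
Proof. by apply: l1normD => //; exact: abszD_le. Qed.
Lemma l1intM p q : (l1int (p * q)%R <= l1int p * l1int q)%N.
Proof. by apply: l1normM => //; [exact: abszD_le|exact: abszM_le]. Qed.
Lemma l1intN p : l1int (- p) = l1int p.
Proof. by apply: l1normN => a; rewrite abszN. Qed.
Lemma l1int1 : l1int 1 = 1%N.
Proof. by rewrite /l1int -[1]/(1%:P) l1normC. Qed.

(** Row [i] of t I - M has total norm at most 1 + C, the variable t on the diagonal contributing
    1. *)
Lemma char_poly_l1_bound N (M : 'M[{poly int}]_N) C :
    (forall i, (\sum_j l1int (M i j) <= C)%N) ->
  (l1int2 (char_poly M) <= (1 + C) ^ N)%N.
Proof.
move=> rowM; rewrite /char_poly.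
apply: leq_trans (submult_det_bound _ _ _ _ _ _) _.
- exact: l1norm0 l1int0.
- by rewrite /l1int2 -[1]/(1%:P) (l1normC l1int0) l1int1.
- by move=> p; apply: l1normN l1intN.
- exact: l1normD l1int0 l1intD.
- exact: l1normM l1int0 l1intD l1intM.
rewrite -[in leqRHS](card_ord N) -prod_nat_const leq_prod // => i _.
apply: (@leq_trans (\sum_j ((j == i) + l1int (M i j)))%N).
  apply: leq_sum => j _; rewrite !mxE.
  apply: leq_trans (l1normD l1int0 l1intD _ _) _; apply: leq_add.
    rewrite eq_sym; case: eqP => _ /=; last by rewrite mulr0n l1norm0 ?l1int0.
    by rewrite mulr1n (l1normX l1int0) l1int1.
  by rewrite (l1normN _ l1intN) (l1normC l1int0).
rewrite big_split /= leq_add // (bigD1 i) //= eqxx big1 ?addn0 // => j.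
by move/negPf ->.
Qed.

(** * Fixed points of monotone maps *)

Lemma cubic_inverse (R : realType) (e t : R) :
  0 <= e -> 0 <= t -> exists2 w, 0 <= w & w + e * w ^+ 3 = t.
Proof.
move=> e0 t0; pose p : {poly R} := 'X + e *: 'X^3 - t%:P.
have pE w : p.[w] = w + e * w ^+ 3 - t by rewrite /p !hornerE.
have [|w /andP[w0 _] /rootP] := @poly_ivt R p 0 t t0.
  rewrite !pE expr0n /= mulr0 addr0 sub0r oppr_le0 t0 /= addrAC subrr add0r.
  by rewrite mulr_ge0 // exprn_ge0.
by rewrite pE => /eqP; rewrite subr_eq0 => /eqP; exists w.
Qed.

Lemma cubic_le (R : realType) (e a b : R) :
  0 <= e -> 0 <= b -> a + e * a ^+ 3 <= b + e * b ^+ 3 -> a <= b.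
Proof.
move=> e0 b0; apply: contraTT; rewrite -!ltNge => ltba.
by rewrite ltr_leD // ler_wpM2l // lerXn2r // ?nnegrE ?ltW // (le_lt_trans b0).
Qed.

Section Tarski.
Variables (R : realType) (n : nat) (f : ('I_n -> R) -> 'I_n -> R).
Hypothesis f_ge0 : forall x, (forall i, 0 <= x i) -> forall i, 0 <= f x i.
Hypothesis f_mono : forall x y,
  (forall i, 0 <= x i) -> (forall i, x i <= y i) -> forall i, f x i <= f y i.

(* Knaster-Tarski: the pointwise infimum of the nonnegative prefixed points. *)
Lemma least_prefixed_point (y0 : 'I_n -> R) :
    (forall i, 0 <= y0 i) -> (forall i, f y0 i <= y0 i) ->
  exists z, [/\ forall i, 0 <= z i, forall i, f z i = z i &
    forall y, (forall i, 0 <= y i) -> (forall i, f y i <= y i) ->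
      forall i, z i <= y i].
Proof.
move=> y00 fy0.
pose pre (y : 'I_n -> R) := (forall i, 0 <= y i) /\ (forall i, f y i <= y i).
pose E i : R -> Prop := fun t => exists2 y, pre y & t = y i.
have lbE i : classical_sets.has_lbound (E i).
  by exists 0 => _ [y [y_ge0 _] ->].
have neE i : classical_sets.nonempty (E i) by exists (y0 i), y0.
pose z i := inf (E i).
have z_ge0 i : 0 <= z i by apply: lb_le_inf => // _ [y [y_ge0 _] ->].
have z_le y : pre y -> forall i, z i <= y i.
  by move=> py i; apply: (ge_inf (lbE i)); exists y.
have fz_le i : f z i <= z i.
  apply: lb_le_inf => // _ [y py ->].
  by apply: le_trans (py.2 i); apply: f_mono => // k; apply: z_le.
exists z; split=> // [i|y y1 y2 i]; last exact: z_le.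
apply/eqP; rewrite eq_le fz_le /=; apply: z_le.
by split; [exact: f_ge0|move=> k; apply: f_mono => //; exact: f_ge0].
Qed.
End Tarski.

(** * Perturbation of the fixed-point equation by a cubic term *)

Section Perturbation.
Variables (R : realType) (n : nat) (f : ('I_n -> R) -> 'I_n -> R).
Hypothesis f_ge0 : forall x, (forall i, 0 <= x i) -> forall i, 0 <= f x i.
Hypothesis f_mono : forall x y,
  (forall i, 0 <= x i) -> (forall i, x i <= y i) -> forall i, f x i <= f y i.

(** Composing [f] with the inverse [psi] of w + e w^3 gives a monotone map whose fixed points are
    the solutions of the perturbed system; [q] is prefixed for it, so Knaster-Tarski applies. *)
Lemma perturbed_least_fixpoint (q : 'I_n -> R) (e : R) :
    0 <= e -> (forall i, 0 <= q i) -> (forall i, f q i <= q i) ->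
  exists z, [/\ forall i, 0 <= z i,
    forall i, z i + e * z i ^+ 3 = f z i &
    forall y, (forall i, 0 <= y i) ->
      (forall i, f y i <= y i + e * y i ^+ 3) -> forall i, z i <= y i].
Proof.
move=> e0 q0 fq.
have /boolp.choice[psi psiP] : forall t : R, exists w : R,
    0 <= t -> 0 <= w /\ w + e * w ^+ 3 = t.
  move=> t; case: (lerP 0 t) => [t0|_]; last by exists 0.
  by have [w w0 ew] := cubic_inverse e0 t0; exists w.
have psi_ge0 x i : (forall i, 0 <= x i) -> 0 <= psi (f x i).
  by move=> /f_ge0/(_ i)/psiP[].
have psiK x i : (forall i, 0 <= x i) ->
    psi (f x i) + e * psi (f x i) ^+ 3 = f x i.
  by move=> /f_ge0/(_ i)/psiP[].
have pre_psi y : (forall i, 0 <= y i) ->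
    (forall i, f y i <= y i + e * y i ^+ 3) -> forall i, psi (f y i) <= y i.
  by move=> y0 fy i; apply: (cubic_le e0) => //; rewrite psiK.
pose g x i := psi (f x i).
have [|x y x0 xy i||z [z0 fz zle]] := @least_prefixed_point R n g _ _ q q0.
- by move=> x x0 i; apply: psi_ge0.
- apply: (cubic_le e0); first by apply: psi_ge0 => k; apply: le_trans (xy k).
  by rewrite !psiK ?f_mono // => k; apply: le_trans (xy k).
- apply: pre_psi => // i; apply: le_trans (fq i) _.
  by rewrite lerDl mulr_ge0 ?exprn_ge0.
exists z; split=> // [i|y y0 fy]; last by apply: zle => //; apply: pre_psi.
by rewrite -[in RHS]psiK // -/(g z i) fz.
Qed.

(** This is where degree at most 2 enters: a monomial of degree d scales by l^d >= l^2. *)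
Hypothesis f_scale : forall (l : R) x, 0 <= l <= 1 -> (forall i, 0 <= x i) ->
  forall i, l ^+ 2 * f x i <= f (fun k => l * x k) i.

(* The supremum [L] of the perturbed fixed points [z e] is prefixed: for [l < 1]
   one has [l *: L <= z e] for small [e], whence
   [l^2 f(L) <= f(l L) <= f(z e) = z e + e (z e)^3 <= L + e L^3]. *)
Lemma perturbation_limit (q : 'I_n -> R) (e0 H : R) (j : 'I_n) :
    (forall i, 0 <= q i) -> (forall i, f q i <= q i) ->
    (forall y, (forall i, 0 <= y i) -> (forall i, f y i <= y i) ->
      forall i, q i <= y i) ->
    0 < e0 ->
    (forall e z, 0 < e <= e0 -> (forall i, 0 <= z i <= q i) ->
      (forall i, z i + e * z i ^+ 3 = f z i) -> z j <= H) ->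
  q j <= H.
Proof.
move=> q0 fq q_least e0_gt0 zH.
have /boolp.choice[z zP] : forall e : R, exists z : 'I_n -> R, 0 < e ->
    [/\ forall i, 0 <= z i, forall i, z i + e * z i ^+ 3 = f z i &
    forall y, (forall i, 0 <= y i) ->
      (forall i, f y i <= y i + e * y i ^+ 3) -> forall i, z i <= y i].
  move=> e; case: (lerP 0 e) => [e_ge0|e_lt0]; last first.
    by exists q; rewrite ltNge (ltW e_lt0).
  by have [z zP] := perturbed_least_fixpoint e_ge0 q0 fq; exists z.
have z_ge0 e i : 0 < e -> 0 <= z e i by move=> /zP[].
have zE e i : 0 < e -> z e i + e * z e i ^+ 3 = f (z e) i by move=> /zP[].
have z_le_q e i : 0 < e -> z e i <= q i.
  move=> eP; have [_ _] := zP e eP; apply=> // k.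
  by apply: le_trans (fq k) _; rewrite lerDl mulr_ge0 ?exprn_ge0 // ltW.
(* The point [z d] is prefixed for the system with the larger parameter [e], so minimality of [z e]
   applies. *)
have z_anti d e i : 0 < d -> d <= e -> z e i <= z d i.
  move=> d0 de; have e_gt0 := lt_le_trans d0 de.
  have [_ _] := zP e e_gt0; apply=> k; first exact: z_ge0.
  by rewrite -zE // lerD2l ler_wpM2r // exprn_ge0 // z_ge0.
pose E i : R -> Prop := fun t => exists2 e, 0 < e <= e0 & t = z e i.
have neE i : classical_sets.nonempty (E i).
  by exists (z e0 i), e0 => //; rewrite e0_gt0 lexx.
have ubE i : classical_sets.has_ubound (E i).
  by exists (q i) => _ [e /andP[eP _] ->]; apply: z_le_q.
pose L i := sup (E i).
have zL e i : 0 < e <= e0 -> z e i <= L i.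
  by move=> eP; apply: (ub_le_sup (ubE i)); exists e.
have L0 i : 0 <= L i.
  by apply: le_trans (zL e0 i _); [exact: z_ge0|rewrite e0_gt0 lexx].
(* Each coordinate of [L] is approached at some parameter [d k]; since [z] is antitone, the minimum
   of these finitely many parameters serves all coordinates. *)
have near_L l : 0 <= l < 1 -> exists2 d, 0 < d <= e0 & forall k, l * L k <= z d k.
  move=> /andP[l0 l1].
  have /fin_all_exists[d dP] : forall k : 'I_n, exists d : R,
      0 < d <= e0 /\ l * L k <= z d k.
    move=> k; have := L0 k; rewrite le_eqVlt => /predU1P[<-|Lk].
      by exists e0; rewrite e0_gt0 lexx mulr0 z_ge0.
    have eps0 : 0 < (1 - l) * L k by rewrite mulr_gt0 ?subr_gt0.
    have [_ [d dP ->] lt_d] := sup_adherent eps0 (conj (neE k) (ubE k)).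
    exists d; split=> //; apply/ltW; apply: le_lt_trans lt_d.
    by rewrite -/(L k); lra.
  exists (\big[Num.min/e0]_k d k).
    rewrite lt_bigmin ?bigmin_le_id // => k _; by have [/andP[]] := dP k.
  move=> k; have [dk dk'] := dP k; apply: le_trans dk' _.
  apply: z_anti; last exact: bigmin_le.
  by rewrite lt_bigmin // => i _; have [/andP[]] := dP i.
have scaled l i : 0 <= l < 1 -> l ^+ 2 * f L i <= L i.
  move=> lP; have [d /andP[d0 de0] dL] := near_L l lP.
  rewrite leNgt; apply/negP; rewrite -subr_gt0 => gap.
  set g := _ - _ in gap.
  have L3 : 0 < 2 * (L i ^+ 3 + 1) by rewrite mulr_gt0 // ltr_wpDl // exprn_ge0.
  (* This choice makes e L^3 at most half of the gap [g]; the added 1 keeps the denominator positive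
     when L = 0. *)
  pose e := Num.min d (g / (2 * (L i ^+ 3 + 1))).
  have eP : 0 < e by rewrite lt_min d0 divr_gt0.
  have ed : e <= d by rewrite ge_min lexx.
  have ee0 : 0 < e <= e0 by rewrite eP (le_trans ed).
  have : l ^+ 2 * f L i <= L i + e * L i ^+ 3.
    case/andP: (lP) => l0 l1.
    apply: le_trans (f_scale _ L0 i) _; first by rewrite l0 ltW.
    apply: (@le_trans _ _ (f (z e) i)).
      apply: f_mono => k; first exact: mulr_ge0.
      by apply: le_trans (dL k) _; apply: z_anti.
    rewrite -zE // lerD ?zL // ler_wpM2l ?(ltW eP) //.
    by rewrite lerXn2r ?nnegrE ?zL ?z_ge0.
  have : e * (2 * (L i ^+ 3 + 1)) <= g.
    by rewrite -ler_pdivlMr // ge_min lexx orbT.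
  have : 0 <= L i ^+ 3 by rewrite exprn_ge0.
  rewrite /g; nra.
have fL i : f L i <= L i.
  rewrite leNgt; apply/negP => ltL.
  have A0 : 0 < f L i := le_lt_trans (L0 i) ltL.
  (* With A = f L i > L, the factor l = (A + L) / (2 A) is below 1, yet l^2 A = (A + L)^2 / (4 A) >
     L because (A - L)^2 > 0. *)
  have lP : 0 <= (f L i + L i) / (2 * f L i) < 1.
    rewrite divr_ge0 ?addr_ge0 ?mulr_ge0 ?L0 ?(ltW A0) //=.
    by rewrite ltr_pdivrMr ?mulr_gt0 //; lra.
  have := scaled _ i lP; apply/negP; rewrite -ltNge.
  have -> : ((f L i + L i) / (2 * f L i)) ^+ 2 * f L i =
      (f L i + L i) ^+ 2 / (4 * f L i) by field; rewrite gt_eqF.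
  rewrite ltr_pdivlMr ?mulr_gt0 // -subr_gt0.
  have -> : (f L i + L i) ^+ 2 - L i * (4 * f L i) = (f L i - L i) ^+ 2 by ring.
  by rewrite exprn_gt0 // subr_gt0.
apply: le_trans (q_least L L0 fL j) _; apply: ge_sup => // _ [e eP ->].
case/andP: (eP) => e_gt0 _.
by apply: (zH e) => // i; rewrite ?z_ge0 ?z_le_q ?zE.
Qed.
End Perturbation.

(** * Elimination in cubic systems *)

Lemma mmap1D (n : nat) (S : comNzRingType) (x : 'I_n -> S) (m1 m2 : 'X_{1..n}) :
  mmap1 x (m1 + m2)%MM = mmap1 x m1 * mmap1 x m2.
Proof. by apply: commr_mmap1_M => i y; apply: mulrC. Qed.

Lemma mmap1Mn (n : nat) (S : comNzRingType) (x : 'I_n -> S) (m : 'X_{1..n}) k :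
  mmap1 x (m *+ k)%MM = mmap1 x m ^+ k.
Proof.
by rewrite /mmap1 -prodrXl; apply: eq_bigr => i _; rewrite mulmnE exprM.
Qed.

(** For K > 0 the top term is at least u^K and the others sum to at most C u^(K-1), which leaves
    u^(K-1) (u - C) >= 1. *)
Lemma dominant_term (R : realType) (a : nat -> R) K (C u : R) :
    1 <= `|a K| -> 0 <= C -> \sum_(k < K) `|a k| <= C -> C + 1 <= u ->
  1 <= `|\sum_(k < K.+1) a k * u ^+ k|.
Proof.
move=> aK C0 sC uC; have u1 : 1 <= u by rewrite (le_trans _ uC) // lerDr.
have u0 : 0 <= u by rewrite (le_trans _ u1).
case: K aK sC => [|K] aK sC; first by rewrite big_ord1 expr0 mulr1.
rewrite big_ord_recr /= addrC.
have low : `|\sum_(k < K.+1) a k * u ^+ k| <= C * u ^+ K.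
  apply: le_trans (ler_norm_sum _ _ _) _.
  apply: (@le_trans _ _ (\sum_(k < K.+1) `|a k| * u ^+ K)).
    apply: ler_sum => k _; rewrite normrM ler_wpM2l //.
    by rewrite ger0_norm ?exprn_ge0 // ler_weXn2l // -ltnS.
  by rewrite -mulr_suml ler_wpM2r ?exprn_ge0.
have top : u ^+ K.+1 <= `|a K.+1 * u ^+ K.+1|.
  by rewrite normrM (ger0_norm (exprn_ge0 _ u0)) ler_peMl // exprn_ge0.
have uK : 1 <= u ^+ K by rewrite exprn_ege1.
apply: le_trans (lerB_normD _ _).
have : 1 <= u ^+ K.+1 - C * u ^+ K.
  by rewrite exprS -mulrBl (le_trans uK) // ler_peMl ?exprn_ge0 // lerBrDl.
by lra.
Qed.

(** * Integer polynomials at real points and root bounds *)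

Section IntPolyEval.
Variable R : realType.

Definition eval_int (u : R) : {poly int} -> R := horner_eval u \o map_poly intr.

HB.instance Definition _ u :=
  GRing.RMorphism.copy (eval_int u) (horner_eval u \o map_poly intr).

Lemma eval_intE u (p : {poly int}) N : (size p <= N)%N ->
  eval_int u p = \sum_(i < N) (p`_i)%:~R * u ^+ i.
Proof.
move=> sp; rewrite /eval_int /= /horner_eval (@horner_coef_wide _ N).
  by apply: eq_bigr => i _; rewrite coef_map.
by apply: leq_trans (size_poly _ _) sp.
Qed.

(** A Cauchy-type root bound: the leading coefficient is a nonzero integer, so the remaining ones
    sum to at most H - 1 and the top term dominates beyond H. *)
Lemma eval_int_ge1 (r : {poly int}) (H : nat) (t : R) :
  r != 0 -> (l1int r <= H)%N -> H%:R < t -> 1 <= `|eval_int t r|.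
Proof.
move=> r0 rH tH; pose d := (size r).-1; have sr : (size r <= d.+1)%N := leqSpred _.
have lc : (0 < `|lead_coef r|)%N by rewrite absz_gt0 lead_coef_eq0.
rewrite lead_coefE -/d in lc; rewrite (eval_intE _ sr).
rewrite /l1int (l1norm_widen _ sr) // big_ord_recr /= in rH.
apply: (@dominant_term _ (fun i => (r`_i)%:~R) d (\sum_(i < d) absz (r`_i)%R)%N%:R).
- by rewrite -intr_norm -abszE -[_%:~R]/(_%:R) ler1n.
- by [].
- rewrite natr_sum; apply: ler_sum => i _.
  by rewrite -intr_norm -abszE.
- apply: le_trans (ltW tH); rewrite natr1 ler_nat -addn1.
  by apply: leq_trans rH; rewrite leq_add2l.
Qed.

Lemma eval_int_le (r : {poly int}) (b t : R) :
  1 <= b -> 0 <= t <= b -> `|eval_int t r| <= (l1int r)%:R * b ^+ size r.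
Proof.
move=> b1 /andP[t0 tb]; rewrite (eval_intE _ (leqnn _)).
apply: le_trans (ler_norm_sum _ _ _) _.
rewrite /l1int /l1norm natr_sum mulr_suml; apply: ler_sum => i _.
rewrite normrM -intr_norm -abszE ler_wpM2l // normrX ger0_norm //.
apply: (@le_trans _ _ (b ^+ i)); first by rewrite lerXn2r ?nnegrE ?(le_trans t0).
by rewrite ler_weXn2l // ltnW.
Qed.

(** Regroups [F] by powers of u, with coefficients in Z[t]. *)
Lemma eval_int_swap (F : {poly {poly int}}) (u t : R) :
  (map_poly (eval_int u) F).[t] =
  \sum_(k < size (swapXY F)) eval_int t (swapXY F)`_k * u ^+ k.
Proof.
rewrite /eval_int map_poly_comp /= -horner_swapXY swapXY_map.
rewrite (@horner_coef_wide {poly R} (size (swapXY F))) ?size_poly //.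
rewrite horner_sum; apply: eq_bigr => k _.
by rewrite hornerM horner_exp hornerC coef_map.
Qed.

Lemma l1int2_swap (F : {poly {poly int}}) : l1int2 (swapXY F) = l1int2 F.
Proof.
have l1E (G : {poly {poly int}}) a b : (size G <= a)%N -> (sizeY G <= b)%N ->
    l1int2 G = (\sum_(i < a) \sum_(k < b) `|(G`_i`_k)%R|)%N.
  move=> ga gb; rewrite /l1int2 (l1norm_widen l1int0 ga); apply: eq_bigr => i _.
  by apply: l1norm_widen => //; apply: leq_trans (max_size_coefXY _ _) gb.
rewrite (l1E _ (sizeY F) (size F)) ?(l1E F (size F) (sizeY F)) ?leqnn //.
- rewrite exchange_big; apply: eq_bigr => i _; apply: eq_bigr => k _.
  by rewrite coef_swapXY.
- by rewrite sizeYE.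
- by rewrite sizeYE swapXYK.
Qed.

(* For large [u] the root [t] is governed by the leading coefficient of [F]
   as a polynomial in [u], a nonzero integer polynomial of norm at most [H]. *)
Lemma bivariate_root_bound (F : {poly {poly int}}) (H : nat) (b : R) :
    F != 0 -> (l1int2 F <= H)%N ->
  exists2 u0, 0 < u0 & forall u t, u0 <= u -> 0 <= t <= b ->
    (map_poly (eval_int u) F).[t] = 0 -> t <= H%:R.
Proof.
move=> F0 FH; set G := swapXY F.
have G0 : G != 0 by rewrite swapXY_eq0.
pose K := (size G).-1; have sG : size G = K.+1 by rewrite prednK ?size_poly_gt0.
 pose b1 := Num.max b 1.
(* [C] bounds the non-leading coefficients in u for t in [0, b]. The threshold for u depends on b,
   but the final bound H does not. *)
pose C := \sum_(k < K) (l1int G`_k)%:R * b1 ^+ size G`_k.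
have b11 : 1 <= b1 by rewrite le_max lexx orbT.
have C0 : 0 <= C.
  by apply: sumr_ge0 => k _; rewrite mulr_ge0 // exprn_ge0 // (le_trans _ b11).
exists (C + 1) => [|u t uC /andP[t0 tb]]; first by rewrite ltr_wpDl.
rewrite eval_int_swap -/G sG => e0; rewrite leNgt; apply/negP => Ht.
suff : 1 <= `|\sum_(k < K.+1) eval_int t G`_k * u ^+ k|.
  by rewrite e0 normr0 ler10.
apply: (@dominant_term _ (fun k => eval_int t G`_k) K C) => //.
  apply: eval_int_ge1 Ht; first by rewrite -lead_coefE lead_coef_eq0.
  apply: leq_trans FH; rewrite -l1int2_swap; exact: l1norm_coef l1int0 _ _.
apply: ler_sum => k _; apply: eval_int_le => //.
by rewrite t0 le_max tb.
Qed.

End IntPolyEval.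

(** Needed because [eigenvalue] refers to row vectors, while the elimination matrix acts on the
    column of monomials. *)
Lemma char_poly_trmx (S : comNzRingType) N (A : 'M[S]_N) :
  char_poly A^T = char_poly A.
Proof.
rewrite /char_poly -det_tr; congr (\det _); apply/matrixP => i j.
by rewrite !mxE eq_sym.
Qed.

(** * Reduction modulo the cubic relations and the eliminant *)

Section CubicSystem.
Variables (R : realType) (n : nat) (G : 'I_n -> seq (int * 'X_{1..n})) (B : nat).
Hypothesis B_gt0 : (0 < B)%N.
Hypothesis G_norm : forall i, (\sum_(g <- G i) `|g.1| <= B)%N.
Hypothesis G_deg : forall i g, g \in G i -> (mdeg g.2 <= 2)%N.

Definition cubic_solution (u : R) (x : 'I_n -> R) :=
  forall i, x i ^+ 3 = u * \sum_(g <- G i) g.1%:~R * mmap1 x g.2.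

Local Notation box := {ffun 'I_n -> 'I_3}.

(** Strong induction on the degree: replacing a factor x_i^3 by u G_i(x) lowers the degree by at
    least 1 and multiplies the norm by at most B. The coefficients do not depend on u or x. *)
Lemma monomial_reduction (m : 'X_{1..n}) : exists c : box -> {poly int},
  (\sum_b l1int (c b) <= B ^ mdeg m)%N /\
  forall u x, cubic_solution u x ->
    mmap1 x m = \sum_b eval_int u (c b) * \prod_i x i ^+ b i.
Proof.
have [d] := ubnP (mdeg m); elim: d m => // d IHd m md.
case: (boolP [forall i, m i < 3]%N) => [/forallP mlt|].
  pose b0 : box := [ffun i => Ordinal (mlt i)].
  exists (fun b => (b == b0)%:R); split=> [|u x _].
    rewrite (bigD1 b0) //= eqxx l1int1 big1; first by rewrite expn_gt0 B_gt0.
    by move=> b /negPf->; rewrite l1int0.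
  rewrite (bigD1 b0) //= eqxx rmorph1 mul1r [X in _ + X]big1 ?addr0 => [|b /negPf->].
    by rewrite /mmap1; apply: eq_bigr => i _; rewrite ffunE.
  by rewrite rmorph0 mul0r.
rewrite negb_forall => /existsP[i]; rewrite -leqNgt => mi.
pose m' := (m - U_(i) *+ 3)%MM.
have mE : m = (m' + U_(i) *+ 3)%MM.
  rewrite /m' submK //; apply/mnm_lepP => k; rewrite mulmnE mnm1E.
  by case: eqP => [<-|].
have mdE : mdeg m = (mdeg m' + 3)%N by rewrite {1}mE mdegD mdegMn mdeg1.
have mS : mdeg m = (mdeg m).-1.+1 by rewrite mdE addnS.
have /boolp.choice[c cP] : forall g : int * 'X_{1..n}, exists c : box -> {poly int},
    g \in G i -> (\sum_b l1int (c b) <= B ^ (mdeg m).-1)%N /\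
    forall u x, cubic_solution u x ->
      mmap1 x (m' + g.2)%MM = \sum_b eval_int u (c b) * \prod_i x i ^+ b i.
  move=> g; case: (boolP (g \in G i)) => [gG|_]; last by exists (fun=> 0).
  have dg : (mdeg (m' + g.2)%MM <= (mdeg m).-1)%N.
    rewrite mdegD mdE addnS /= leq_add2l; exact: G_deg gG.
  have [|c [c1 c2]] := IHd (m' + g.2)%MM.
    by rewrite -ltnS; apply: leq_trans md; rewrite ltnS [leqRHS]mS ltnS.
  exists c => _; split=> //; apply: leq_trans c1 _; exact: leq_pexp2l.
(* Here ['X] is the parameter u, of norm 1, and [c g] reduces the monomial obtained from the term
   [g] of [G i]. *)
exists (fun b => 'X * \sum_(g <- G i) g.1%:P * c g b); split=> [|u x sol].
  have lX : l1int 'X = 1%N by rewrite /l1int l1normX.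
  apply: (@leq_trans (\sum_b \sum_(g <- G i) absz g.1 * l1int (c g b))).
    apply: leq_sum => b _; apply: leq_trans (l1intM _ _) _; rewrite lX mul1n.
    apply: leq_trans (l1norm_sum _ abszD_le _ _) _ => //.
    apply: leq_sum => g _; exact: l1norm_mulC abszM_le _ _.
  rewrite exchange_big /=.
  apply: (@leq_trans (\sum_(g <- G i) absz g.1 * B ^ (mdeg m).-1)).
    rewrite big_seq [leqRHS]big_seq; apply: leq_sum => g gG.
    by rewrite -big_distrr leq_mul2l (cP g gG).1 orbT.
  rewrite [in leqRHS]mS.
  by rewrite -big_distrl expnS leq_mul2r G_norm orbT.
have -> : mmap1 x m = x i ^+ 3 * mmap1 x m'.
  by rewrite {1}mE mmap1D mmap1Mn mmap1U mulrC.
rewrite sol -mulrA mulr_suml.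
under [in RHS]eq_bigr do rewrite rmorphM /= rmorph_sum /= -mulrA mulr_suml.
rewrite -mulr_sumr; congr (_ * _).
  by rewrite /eval_int /= /horner_eval map_polyX hornerX.
rewrite exchange_big /= big_seq [RHS]big_seq; apply: eq_bigr => g gG.
under eq_bigr do rewrite rmorphM /= -mulrA.
rewrite -mulr_sumr -(cP g gG).2 // mmap1D -mulrA [mmap1 x m' * _]mulrC.
by congr (_ * _); rewrite /eval_int /= /horner_eval map_polyC hornerC.
Qed.

(* The characteristic polynomial of multiplication by [x j] on the span of the
   monomials with all exponents at most 2. *)
Lemma cubic_eliminant (j : 'I_n) : exists F : {poly {poly int}},
  [/\ F != 0, (l1int2 F <= (1 + B ^ (2 * n + 1)) ^ (3 ^ n))%N &
    forall u x, cubic_solution u x -> (map_poly (eval_int u) F).[x j] = 0].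
Proof.
(* The box monomial with exponents [a], multiplied by x_j; its reduction gives row [a] of the
   matrix. *)
pose mon (a : box) : 'X_{1..n} := ([multinom (a i : nat) | i < n] + U_(j))%MM.
have mon_deg a : (mdeg (mon a) <= 2 * n + 1)%N.
  rewrite mdegD mdeg1 leq_add2r mdegE mulnC -[in leqRHS](card_ord n).
  by rewrite -sum_nat_const leq_sum // => i _; rewrite mnmE -ltnS.
have /fin_all_exists[c cP] := fun a => monomial_reduction (mon a).
pose M : 'M[{poly int}]_#|box| := \matrix_(a, b) c (enum_val a) (enum_val b).
exists (char_poly M); split=> [||u x sol].
- exact: monic_neq0 (char_poly_monic M).
- have <- : #|box| = (3 ^ n)%N by rewrite card_ffun !card_ord.
  apply: char_poly_l1_bound => a; have [c1 _] := cP (enum_val a).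
  apply: leq_trans (leq_trans c1 _); last by rewrite leq_pexp2l.
  rewrite [leqRHS](reindex _ (onW_bij _ (enum_val_bij box))).
  by apply: eq_leq; apply: eq_bigr => b _; rewrite mxE.
apply/eqP; rewrite map_char_poly -char_poly_trmx -/(root _ _) -eigenvalue_root_char.
(* The eigenvector lists the values at [x] of the box monomials. It is nonzero because the constant
   monomial has value 1. *)
apply/eigenvalueP; exists (\row_a \prod_i x i ^+ (enum_val a : box) i).
  apply/rowP => a; rewrite !mxE.
  have [_ /(_ u x sol)] := cP (enum_val a).
  rewrite mmap1D mmap1U mulrC.
  have -> : mmap1 x [multinom (enum_val a i : nat) | i < n] =
      \prod_i x i ^+ enum_val a i by apply: eq_bigr => i _; rewrite mnmE.
  move=> ->; rewrite (reindex _ (onW_bij _ (enum_val_bij box))) /=.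
  by apply: eq_bigr => b _; rewrite !mxE mulrC.
apply/eqP => /rowP/(_ (enum_rank [ffun=> ord0])); rewrite !mxE enum_rankK.
rewrite big1 => [/eqP|i _]; first by rewrite oner_eq0.
by rewrite ffunE.
Qed.

End CubicSystem.

(** * Monotone polynomial systems *)

Section MonomialOrder.
Variables (R : realType) (n : nat).
Implicit Types (x y : 'I_n -> R) (m : 'X_{1..n}).

Lemma mmap1_ge0 x m : (forall i, 0 <= x i) -> 0 <= mmap1 x m.
Proof. by move=> x0; apply: prodr_ge0 => i _; apply: exprn_ge0. Qed.

Lemma mmap1_mono x y m :
  (forall i, 0 <= x i) -> (forall i, x i <= y i) -> mmap1 x m <= mmap1 y m.
Proof.
move=> x0 xy; apply: ler_prod => i _; rewrite exprn_ge0 //=.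
by rewrite lerXn2r ?nnegrE // (le_trans (x0 i)).
Qed.

Lemma mmap1_scale (l : R) x m :
  mmap1 (fun k => l * x k) m = l ^+ mdeg m * mmap1 x m.
Proof.
rewrite /mmap1 mdegE -prodrXr -big_split.
by apply: eq_bigr => i _; rewrite exprMn.
Qed.

Lemma meval_ratrE (p : {mpoly rat[n]}) x :
  (map_mpoly ratr p).@[x] = \sum_(m <- msupp p) ratr p@_m * mmap1 x m.
Proof.
rewrite mevalE (perm_big _ (msupp_map_mpoly _ (fmorph_inj _))).
by apply: eq_bigr => m _; rewrite mcoeff_map_mpoly.
Qed.
End MonomialOrder.

Section MonotonePolynomialSystem.
Variables (R : realType) (n : nat) (P : 'I_n -> {mpoly rat[n]}) (q : 'I_n -> R).
Hypotheses (mpsP : is_MPS P) (quadP : quadratic P) (lfpq : is_LFP P q).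

Let f (x : 'I_n -> R) i := (map_mpoly ratr (P i)).@[x].

Let ratr_coef_ge0 i m : 0 <= ratr (P i)@_m :> R.
Proof. by rewrite ler0q mpsP. Qed.

Let mdeg_le2 i m : m \in msupp (P i) -> (mdeg m <= 2)%N.
Proof. by move=> /msize_mdeg_lt mi; rewrite -ltnS (leq_trans mi). Qed.

Lemma mps_ge0 x : (forall i, 0 <= x i) -> forall i, 0 <= f x i.
Proof.
by move=> x0 i; rewrite /f meval_ratrE sumr_ge0 // => m _; rewrite mulr_ge0 ?mmap1_ge0.
Qed.

Lemma mps_mono x y :
  (forall i, 0 <= x i) -> (forall i, x i <= y i) -> forall i, f x i <= f y i.
Proof.
move=> x0 xy i; rewrite /f !meval_ratrE ler_sum // => m _.
by rewrite ler_wpM2l ?mmap1_mono.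
Qed.

Lemma mps_scale (l : R) x : 0 <= l <= 1 -> (forall i, 0 <= x i) ->
  forall i, l ^+ 2 * f x i <= f (fun k => l * x k) i.
Proof.
move=> /andP[l0 l1] x0 i; rewrite /f !meval_ratrE mulr_sumr big_seq [leRHS]big_seq.
apply: ler_sum => m mi; rewrite mulrCA ler_wpM2l // mmap1_scale.
by rewrite ler_wpM2r ?mmap1_ge0 // ler_wiXn2l ?(mdeg_le2 mi).
Qed.

Lemma lfp_ge0 i : 0 <= q i. Proof. exact: lfpq.1.1. Qed.

Lemma lfpE i : f q i = q i. Proof. by rewrite [RHS]lfpq.1.2. Qed.

(** Knaster-Tarski yields a fixed point below any prefixed point, so leastness among fixed points
    carries over. *)
Lemma lfp_le_prefixed y : (forall i, 0 <= y i) -> (forall i, f y i <= y i) ->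
  forall i, q i <= y i.
Proof.
move=> y0 fy i.
have [z [z0 fz zy]] := least_prefixed_point mps_ge0 mps_mono y0 fy.
by apply: le_trans (zy y y0 fy i); apply: lfpq.2; split=> // k; rewrite -[LHS]fz.
Qed.

(** * Coefficient sizes, propagation of positivity and the lower bound *)

Lemma ltn_bitlen k : (k < 2 ^ bitlen k)%N.
Proof. exact: trunc_log_ltn. Qed.

Lemma coef_size_le i m : m \in msupp (P i) -> (coef_size (P i)@_m <= enc_size P)%N.
Proof.
move=> mi; rewrite /enc_size (bigD1 i) //= /poly_size (bigD1_seq m) ?msupp_uniq //=.
by do 3!apply: leq_trans (leq_addr _ _).
Qed.

Lemma coef_lower_bound i m : m \in msupp (P i) ->
  2 ^- enc_size P <= ratr (P i)@_m :> R.
Proof.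
move=> mi; set c := (P i)@_m.
have c0 : 0 < c by rewrite lt_neqAle eq_sym -mcoeff_msupp mi mpsP.
have num1 : 1 <= (numq c)%:~R :> R by rewrite ler1z -gtz0_ge1 numq_gt0.
have den0 : 0 < (denq c)%:~R :> R by rewrite ltr0z denq_gt0.
apply: (@le_trans _ _ (denq c)%:~R^-1); last first.
  by rewrite /ratr ler_peMl // invr_ge0 ltW.
rewrite lef_pV2 ?posrE ?exprn_gt0 // -[denq c]gtz0_abs ?denq_gt0 //.
rewrite -[_%:~R]/(_%:R) -natrX ler_nat.
apply: leq_trans (ltnW (ltn_bitlen _)) _; rewrite leq_exp2l //.
by apply: leq_trans (coef_size_le mi); rewrite leq_addl.
Qed.

(** Coordinates that become positive once those in [S] are; a constant term starts the process from
    the empty set. *)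
Definition positive_step (S : {set 'I_n}) : {set 'I_n} :=
  [set i | has (fun m : 'X_{1..n} => [forall j, (m j != 0) ==> (j \in S)])
               (msupp (P i))].

Lemma positive_step_mono : {homo positive_step : X Y / X \subset Y}.
Proof.
move=> X Y /subsetP XY; apply/subsetP => i; rewrite !inE.
apply: sub_has => m /forallP mX; apply/forallP => j; apply/implyP => mj.
by apply: XY; have := mX j; rewrite mj.
Qed.

(** Setting [q] to 0 outside the fixed set gives a prefixed point: for i outside it, every monomial
    of P_i contains a variable outside it. Leastness and q > 0 then force the set to be full. *)
Lemma fixset_positive_step : (forall i, 0 < q i) ->
  forall i, i \in fixset positive_step.
Proof.
move=> q_gt0; set S := fixset _.
pose y i : R := if i \in S then q i else 0.
have y0 i : 0 <= y i by rewrite /y; case: ifP => // _; apply: lfp_ge0.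
have yq i : y i <= q i by rewrite /y; case: ifP => // _; apply: lfp_ge0.
suff fy i : f y i <= y i.
  move=> i; have := lfp_le_prefixed y0 fy i; rewrite /y; case: ifP => // _.
  by rewrite leNgt q_gt0.
rewrite {2}/y; case: ifP => [_|/negbT]; first by rewrite -lfpE mps_mono.
rewrite -[S](fixsetK positive_step_mono) -/S inE => /hasPn noS.
rewrite /f meval_ratrE big_seq big1 // => m /noS.
rewrite negb_forall => /existsP[j]; rewrite negb_imply => /andP[mj jS].
rewrite /mmap1 (bigD1 j) //= /y (negPf jS) expr0n (negPf mj) /=.
by rewrite mul0r mulr0.
Qed.

(** A coordinate entering at step k + 1 is at least 2^-s times a product of at most two earlier
    ones, so the exponents obey E_(k+1) = s + 2 E_k, with solution s (2^k - 1). *)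
Lemma lfp_lower_bound : (forall i, 0 < q i) ->
  forall i, 2 ^- (enc_size P * (2 ^ n - 1)) <= q i.
Proof.
move=> q_gt0 i; set s := enc_size P.
have iter_bound k j : j \in iter k positive_step set0 ->
    2 ^- (s * (2 ^ k - 1)) <= q j.
  elim: k j => [|k IHk] j; first by rewrite inE.
  rewrite iterS inE => /hasP[m mj /forallP mS].
  set d : R := 2 ^- (s * (2 ^ k - 1)) in IHk.
  have d0 : 0 <= d by rewrite invr_ge0 exprn_ge0.
  have d1 : d <= 1 by rewrite invf_le1 ?exprn_gt0 // exprn_ege1 // ler1n.
  have -> : 2 ^- (s * (2 ^ k.+1 - 1)) = 2 ^- s * d ^+ 2 :> R.
    rewrite /d -!exprVn -exprM -exprD; congr (_ ^+ _).
    rewrite expnS; have : (0 < 2 ^ k)%N by rewrite expn_gt0.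
    by case: (2 ^ k)%N => // a _; rewrite mul2n -addnn addSn !subn1 /=; nia.
  rewrite -lfpE /f meval_ratrE (bigD1_seq m) ?msupp_uniq //=.
  apply: (@le_trans _ _ (ratr (P j)@_m * mmap1 q m)); last first.
    by rewrite lerDl sumr_ge0 // => k' _; rewrite mulr_ge0 ?mmap1_ge0 //; apply: lfp_ge0.
  apply: ler_pM; rewrite ?invr_ge0 ?exprn_ge0 ?coef_lower_bound //.
  apply: (@le_trans _ _ (d ^+ mdeg m)); first by rewrite ler_wiXn2l ?(mdeg_le2 mj).
  rewrite mdegE -prodrXr /mmap1; apply: ler_prod => a _.
  rewrite exprn_ge0 //=; have := mS a; case: eqP => [-> _|_ /= aS] //.
  by rewrite lerXn2r ?nnegrE ?lfp_ge0 ?IHk.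
(* By definition [fixset] is the n-th iterate from the empty set. *)
have := fixset_positive_step q_gt0 i; rewrite /fixset /= card_ord.
exact: iter_bound.
Qed.

(** * Clearing denominators and the upper bound *)

Definition common_den : nat := (\prod_i \prod_(m <- msupp (P i)) `|denq (P i)@_m|)%N.

(** The terms of D (P_i(x) - x_i) with D = [common_den]; the monomial x_i may be listed twice. *)
Definition cubic_rhs i : seq (int * 'X_{1..n}) :=
  (- (common_den : int), U_(i)%MM) ::
  [seq (numq (P i)@_m * (common_den %/ `|denq (P i)@_m|)%N, m) | m <- msupp (P i)].

Lemma common_den_gt0 : (0 < common_den)%N.
Proof.
by apply: prodn_gt0 => i; apply: prodn_gt0 => m; rewrite absz_gt0 denq_neq0.
Qed.

Lemma den_dvd_common i m : m \in msupp (P i) -> (`|denq (P i)@_m| %| common_den)%N.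
Proof.
move=> mi; rewrite /common_den (bigD1 i) //= dvdn_mulr //.
by rewrite (bigD1_seq m) ?msupp_uniq //= dvdn_mulr.
Qed.

Lemma cubic_rhsE (x : 'I_n -> R) i :
  \sum_(g <- cubic_rhs i) g.1%:~R * mmap1 x g.2 = common_den%:R * (f x i - x i).
Proof.
rewrite big_cons /= big_map /= mmap1U mulrBr addrC rmorphN /= mulNr; congr (_ - _).
rewrite /f meval_ratrE mulr_sumr big_seq [RHS]big_seq; apply: eq_bigr => m mi /=.
rewrite mulrA; congr (_ * _); rewrite -[in RHS](divnK (den_dvd_common mi)).
set k := (_ %/ _)%N; rewrite natrM rmorphM /= /ratr.
have -> : `|denq (P i)@_m|%:R = (denq (P i)@_m)%:~R :> R.
  by rewrite -[in RHS](@gtz0_abs (denq _)) ?denq_gt0.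
by rewrite -[k%:~R]/(k%:R); field; rewrite intr_eq0 denq_neq0.
Qed.

Lemma cubic_rhs_deg i g : g \in cubic_rhs i -> (mdeg g.2 <= 2)%N.
Proof.
rewrite inE => /predU1P[->|/mapP[m mi ->]]; first by rewrite mdeg1.
exact: mdeg_le2 mi.
Qed.

(** The norm is at most D (1 + sum of numerators), hence at most D times the product of all
    (numerator + 1). As D is the product of all denominators, each coefficient contributes one
    factor, at most 2 to its bit size. *)
Lemma cubic_rhs_norm i : (\sum_(g <- cubic_rhs i) `|g.1| <= 2 ^ enc_size P)%N.
Proof.
pose num k m := `|numq (P k)@_m|%N.
apply: (@leq_trans (common_den * \prod_k \prod_(m <- msupp (P k)) (num k m).+1)%N).
  apply: (@leq_trans (common_den * (1 + \sum_(m <- msupp (P i)) num i m))%N).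
    rewrite big_cons /= big_map /= abszN mulnDr muln1 leq_add2l big_distrr /=.
    apply: leq_sum => m _; rewrite abszM mulnC leq_mul2r leq_div.
    by rewrite orbT.
  rewrite leq_mul2l; apply/orP; right.
  apply: (@leq_trans (\prod_(m <- msupp (P i)) (num i m).+1)%N).
    elim: (msupp _) => [|m r IHr]; first by rewrite !big_nil.
    by rewrite !big_cons mulSn addnCA addnC leq_add // leq_pmulr // prodn_gt0.
  by rewrite [leqRHS](bigD1 i) //= leq_pmulr // prodn_gt0 // => k; rewrite prodn_gt0.
rewrite /common_den -big_split /= /enc_size expn_sum leq_prod // => k _.
rewrite -big_split /= /poly_size expn_sum leq_prod // => m _.
apply: (@leq_trans (2 ^ coef_size (P k)@_m)%N); last by rewrite leq_exp2l ?leq_addr.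
by rewrite /coef_size expnD mulnC leq_mul ?ltn_bitlen // ltnW ?ltn_bitlen.
Qed.

Lemma lfp_upper_bound j :
  q j <= ((1 + (2 ^ enc_size P) ^ (2 * n + 1)) ^ (3 ^ n))%N%:R.
Proof.
have B0 : (0 < 2 ^ enc_size P)%N by rewrite expn_gt0.
have [F [F0 FH Froot]] := cubic_eliminant R B0 cubic_rhs_norm cubic_rhs_deg j.
have [u0 u0_gt0 root_le] := bivariate_root_bound (q j) F0 FH.
have D0 : 0 < common_den%:R :> R by rewrite ltr0n common_den_gt0.
(* With u = 1/(D e), the bound e <= 1/(D u0) says exactly that u >= u0. *)
apply: (@perturbation_limit R n f mps_ge0 mps_mono mps_scale q
  ((common_den%:R * u0)^-1)).
- exact: lfp_ge0.
- by move=> i; rewrite lfpE.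
- exact: lfp_le_prefixed.
- by rewrite invr_gt0 mulr_gt0.
move=> e z /andP[e0 eu] zq zE.
have De : 0 < common_den%:R * e by rewrite mulr_gt0.
apply: (root_le (common_den%:R * e)^-1) => //.
  rewrite -[u0]invrK lef_pV2 ?posrE ?invr_gt0 //.
  by rewrite -ler_pdivlMl // -invfM.
apply: Froot => i; rewrite cubic_rhsE -zE.
by field; rewrite !gt_eqF.
Qed.
End MonotonePolynomialSystem.

Theorem theorem1 (R : realType) (n : nat) (n_gt0 : (0 < n)%N)
    (P : 'I_n -> {mpoly rat[n]}) (q : 'I_n -> R)
    (mpsP : is_MPS P) (quadP : quadratic P)
    (lfpq : is_LFP P q) (q_gt0 : forall i, 0 < q i) :
  (2 : R) ^- (enc_size P * (2 ^ n - 1)) <= vec_min n_gt0 q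
  /\
  vec_max n_gt0 q <=
    2 `^ (2 * (n.+1)%:R
          * ((enc_size P)%:R + 2 * (n.+1)%:R * log2 (2 * n%:R + 2))
          * 5 ^+ n).
Proof.
split; first by apply: le_bigmin => [|i _]; apply: lfp_lower_bound.
set s := enc_size P; set E := (X in 2 `^ X).
suff ub i : q i <= 2 `^ E by apply: bigmax_le.
apply: le_trans (lfp_upper_bound mpsP quadP lfpq i) _.
(* Uses 1 + 2^k <= 2^(k+1) with k = s (2n + 1). *)
apply: (@le_trans _ _ (2 ^+ ((1 + s * (2 * n + 1)) * 3 ^ n))).
  rewrite -natrX ler_nat expnM leq_exp2r ?expn_gt0 // -expnM -/s [(1 + s * _)%N]add1n.
  by rewrite expnS [(2 * 2 ^ _)%N]mul2n -addnn leq_add2r expn_gt0.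
rewrite -powR_mulrn //; apply: ler_powR; first by rewrite ler1n.
have log_ge1 : 1 <= log2 (2 * n%:R + 2) :> R.
  have ln2 : 0 < ln 2 :> R by rewrite ln_gt0 // ltr1n.
  rewrite /log2 ler_pdivlMr // mul1r ler_ln ?posrE ?ltr0n //.
    by rewrite lerDr mulr_ge0.
  by rewrite ltr_wpDl ?mulr_ge0.
(* The factors are compared separately: 3^n <= 5^n, and 1 + s (2n + 1) against the linear factor,
   whose logarithmic part absorbs the 1. *)
rewrite natrM natrX /E; apply: ler_pM; [by []|exact: exprn_ge0| |]; last first.
  by rewrite lerXn2r ?nnegrE // ler_nat.
rewrite natrD !natrM natrD !natrM -/s -[n.+1%:R]natr1.
set L := log2 _ in log_ge1 *.
have n0 : 0 <= n%:R :> R by [].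
have s0 : 0 <= s%:R :> R by [].
move: n0 s0 log_ge1; move: (n%:R : R) (s%:R : R) L => a b L a0 b0 L1.
have ab : 0 <= a * b by rewrite mulr_ge0.
have aL : 1 <= (a + 1) ^+ 2 * L by rewrite -[leLHS]mul1r ler_pM // exprn_ege1 // lerDr.
have -> : 2 * (a + 1) * (b + 2 * (a + 1) * L) =
    2 * (a * b) + 2 * b + 4 * ((a + 1) ^+ 2 * L) by ring.
lra.
Qed.
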